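(* Suppose all groups are extreme, i.e. $y_j\in\{0,n_j\}$ for every $j=1,\dots,k$. Let $f$ be any improper hyper-prior density on $(0,\infty)$ for $r$ and, independently, let $g$ be any hyper-prior density (proper or improper) on $\mathbf R^m$ for $\boldsymbol\beta$. Then the posterior density function of the hyper-parameters, $\pi_{\mathrm{hyp.post}}(r,\boldsymbol\beta\mid\boldsymbol y)\propto f(r)\,g(\boldsymbol\beta)\,L(r,\boldsymbol\beta)$, is always improper.
   Context: Beta-Binomial-Logit model. There are $k\ge 1$ groups; group $j$ has an integer number of trials $n_j\ge 1$, an observed number of successes $y_j\in\{0,1,\dots,n_j\}$, and a fixed covariate vector $\boldsymbol x_j\in\mathbf R^m$, with $k\ge m\ge 1$. Put $\boldsymbol y=(y_1,\dots,y_k)^\top$. The hyper-parameters are $r\in(0,\infty)$ and $\boldsymbol\beta\in\mathbf R^m$. Write $$p^E_j=p^E_j(\boldsymbol\beta)=\frac{\exp(\boldsymbol x_j^\top\boldsymbol\beta)}{1+\exp(\boldsymbol x_j^\top\boldsymbol\beta)},\qquad q^E_j=1-p^E_j .$$ The likelihood function (a product of Beta-Binomial probability mass functions) is $$L(r,\boldsymbol\beta)=\prod_{j=1}^k\binom{n_j}{y_j}\frac{B(y_j+rp^E_j,\;n_j-y_j+rq^E_j)}{B(rp^E_j,\;rq^E_j)},$$ where $B(a,b)=\int_0^1 v^{a-1}(1-v)^{b-1}\,dv$ for $a,b>0$ is the beta function. A hyper-prior density is a nonnegative measurable function that is not almost everywhere zero; it is proper if its integral is finite and improper if its integral is infinite.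 The posterior $\pi_{\mathrm{hyp.post}}(r,\boldsymbol\beta\mid\boldsymbol y)\propto f(r)g(\boldsymbol\beta)L(r,\boldsymbol\beta)$ is called proper if $\int_{\mathbf R^m}\int_0^\infty f(r)g(\boldsymbol\beta)L(r,\boldsymbol\beta)\,dr\,d\boldsymbol\beta<\infty$ and improper if this integral is infinite. *)

(* Defs.v *)
From HB Require Import structures.
From mathcomp Require Import all_boot all_order all_algebra.
From mathcomp Require Import all_classical all_reals all_analysis.

Set Implicit Arguments.
Unset Strict Implicit.
Unset Printing Implicit Defensive.

Import Order.TTheory GRing.Theory Num.Theory.
Import numFieldNormedType.Exports.

Local Open Scope classical_set_scope.
Local Open Scope ring_scope.

(* R^m is represented by m.-tuple R, which carries the sigma-algebra generated by
   the coordinates, i.e. the Borel sets of R^m.  Lebesgue measure on it is built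
   by induction on m as a product measure; lebesgue_tuple_box is the property
   that characterizes it. *)
Section lebesgue_tuple.
Context {R : realType}.
Implicit Types m : nat.

Definition cons_tuple m (p : measurableTypeR R * m.-tuple R) : m.+1.-tuple R :=
  [tuple of p.1 :: p.2].

Definition uncons_tuple m (t : m.+1.-tuple R) : measurableTypeR R * m.-tuple R :=
  (thead t, [tuple of behead t]).

Lemma cons_tupleK m : cancel (@cons_tuple m) (@uncons_tuple m).
Proof. by move=> [a t]; congr pair => //; apply/val_inj. Qed.

Lemma measurable_cons_tuple m : measurable_fun setT (@cons_tuple m).
Proof. exact: measurable_cons. Qed.

Lemma measurable_uncons_tuple m : measurable_fun setT (@uncons_tuple m).
Proof.
apply/measurable_fun_pair; [exact: measurable_tnth|exact: measurable_behead].
Qed.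

Section lebesgue_cons.
Variables (m : nat) (nu : {sigma_finite_measure set (m.-tuple R) -> \bar R}).

Definition lebesgue_cons : set (m.+1.-tuple R) -> \bar R :=
  pushforward (lebesgue_measure \x nu)%E (@cons_tuple m).

Let mcons := @measurable_cons_tuple m.

Let lebesgue_cons0 : lebesgue_cons set0 = 0%E.
Proof. exact: measure0. Qed.

Let lebesgue_cons_ge0 A : (0 <= lebesgue_cons A)%E.
Proof. exact: measure_ge0. Qed.

Let lebesgue_cons_sigma_additive : semi_sigma_additive lebesgue_cons.
Proof. exact: measure_semi_sigma_additive. Qed.

HB.instance Definition _ := isMeasure.Build _ _ _ lebesgue_cons
  lebesgue_cons0 lebesgue_cons_ge0 lebesgue_cons_sigma_additive.

Let lebesgue_cons_sigma_finite : sigma_finite setT lebesgue_cons.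
Proof.
have /sigma_finiteP[F [TF ndF Foo]] := sigma_finiteT (@lebesgue_measure R).
have /sigma_finiteP[G [TG ndG Goo]] := sigma_finiteT nu.
exists (fun n => @uncons_tuple m @^-1` (F n `*` G n)).
  rewrite -preimage_bigcup -[LHS](preimage_setT (@uncons_tuple m)).
  congr (_ @^-1` _); apply/esym/seteqP; split=> // -[x y] _.
  have [n _ Fx] : (\bigcup_n F n) x by rewrite -TF.
  have [k _ Gy] : (\bigcup_n G n) y by rewrite -TG.
  exists (maxn n k) => //; split.
    by move: x Fx; exact/subsetPset/ndF/leq_maxl.
  by move: y Gy; exact/subsetPset/ndG/leq_maxr.
move=> n; have [mF Fn] := Foo n; have [mG Gn] := Goo n; split.
  rewrite -[X in measurable X]setTI; apply: measurable_uncons_tuple => //.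
  exact: measurableX.
rewrite /lebesgue_cons /pushforward -comp_preimage.
rewrite (_ : _ \o _ = id) ?preimage_id; last first.
  by apply/funext => p /=; rewrite cons_tupleK.
by rewrite product_measure1E// lte_mul_pinfty// ge0_fin_numE.
Qed.

HB.instance Definition _ := Measure_isSigmaFinite.Build _ _ _ lebesgue_cons
  lebesgue_cons_sigma_finite.

End lebesgue_cons.

Fixpoint lebesgue_tuple m : {sigma_finite_measure set (m.-tuple R) -> \bar R} :=
  match m with
  | 0 => \d_[tuple of [::]]
  | m'.+1 => lebesgue_cons (lebesgue_tuple m')
  end.

Lemma lebesgue_tuple_box m (A : 'I_m -> set R) :
  (forall i, measurable (A i)) ->
  lebesgue_tuple m [set t | forall i, A i (tnth t i)] =
  (\prod_(i < m) lebesgue_measure (A i))%E.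
Proof.
elim: m A => [|m IH] A mA.
  by rewrite big_ord0 /= diracE mem_set// => -[].
rewrite big_ord_recl /= /lebesgue_cons /pushforward.
rewrite -(IH (fun i => A (lift ord0 i)))//.
rewrite -product_measure1E; [|exact: mA|]; last first.
  rewrite (_ : [set t | _] = \bigcap_(i in [set: 'I_m])
      ((fun t : m.-tuple R => tnth t i) @^-1` A (lift ord0 i))); last first.
    by apply/seteqP; split=> t /= h i; [move=> _|]; exact: h.
  apply: fin_bigcap_measurable => // i _.
  by rewrite -[X in measurable X]setTI; exact: (measurable_tnth i).
congr (_ _); apply/seteqP; split=> [[a t] /= h|[a t] /= [? ht] i].
  by split=> [|i]; [exact: (h ord0)|have := h (lift ord0 i); rewrite tnthS].
by case: (unliftP ord0 i) => [j|] ->//; rewrite tnthS.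
Qed.

End lebesgue_tuple.

(* Only meaningful for 0 < a and 0 < b, where the integral is finite. *)
Definition beta_real (R : realType) (a b : R) : R :=
  \int[lebesgue_measure]_(v in `]0%R, 1%R[) (v `^ (a - 1) * (1 - v) `^ (b - 1)).

Section beta_binomial_logit.
Context {R : realType} (k m : nat).
Variables (n y : 'I_k -> nat) (x : 'I_k -> m.-tuple R).
Implicit Types (r : R) (b : m.-tuple R).

Definition dot (u v : m.-tuple R) : R := \sum_(i < m) tnth u i * tnth v i.

Definition pE b (j : 'I_k) : R := expR (dot (x j) b) / (1 + expR (dot (x j) b)).

Definition qE b (j : 'I_k) : R := 1 - pE b j.

Definition likelihood r b : R :=
  \prod_(j < k) (('C(n j, y j))%:R *
    (beta_real ((y j)%:R + r * pE b j) ((n j)%:R - (y j)%:R + r * qE b j)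
     / beta_real (r * pE b j) (r * qE b j))).

Definition posterior_integral (f : R -> R) (g : m.-tuple R -> R) : \bar R :=
  (\int[lebesgue_tuple m]_b \int[lebesgue_measure]_(r in `]0%R, +oo[)
    (f r * g b * likelihood r b)%:E)%E.

Definition posterior_improper f g := posterior_integral f g = +oo%E.

End beta_binomial_logit.

(* mu is the reference (Lebesgue) measure and D the domain of the density; the
   values of the density outside of D are irrelevant. *)
Section hyperprior.
Context d (T : measurableType d) (R : realType).
Variables (mu : {measure set T -> \bar R}) (D : set T).
Implicit Types h : T -> R.

Definition hyperprior_density h :=
  [/\ measurable_fun D h, forall t, D t -> 0 <= h t
    & ~ {ae mu, forall t, D t -> h t = 0}].

Definition improper_density h := (\int[mu]_(t in D) (h t)%:E)%E = +oo%E.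

End hyperprior.

(* Main.v *)
(* For an extreme group the ratio of beta functions in the likelihood is
   B(n + a, b) / B(a, b) (or its mirror image) with a = r p, b = r q, and it
   equals \prod_(i < n) (a + i) / (a + b + i) >= (a / (a + b)) ^ n = p ^ n, a
   bound that does not depend on r.  Hence the likelihood is bounded below,
   uniformly in r, by a positive function of beta, so the inner integral is
   +oo wherever g > 0 and 0 elsewhere; and g > 0 on a set of positive measure.
   The recurrence for B follows from integrating the derivative of
   v ^ a (1 - v) ^ b over ]0, 1[. *)
Require Import Defs.
From HB Require Import structures.
From mathcomp Require Import all_boot all_order all_algebra.
From mathcomp Require Import all_classical all_reals all_analysis.
From mathcomp Require Import measurable_realfun ring lra.

Set Implicit Arguments.
Unset Strict Implicit.
Unset Printing Implicit Defensive.

Import Order.TTheory GRing.Theory Num.Theory.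
Import numFieldNormedType.Exports.

Local Open Scope classical_set_scope.
Local Open Scope ring_scope.

(** * Fundamental theorem of calculus on an open interval, with limits at the endpoints *)

Section improper_integral.
Variable R : realType.
Local Notation mu := (@lebesgue_measure R).

(** Exhausts the open interval by compact ones, on which continuous functions are integrable. *)
Lemma bigcup_itv_shrink (a b : R) (e : R^nat) : (forall n, 0 < e n) ->
  e n @[n --> \oo] --> 0 ->
  \bigcup_n `[a + e n, b - e n]%classic = `]a, b[%classic.
Proof.
move=> e0 ecvg; apply/seteqP; split=> [x [n _ /=]|x /=].
  rewrite !in_itv/= => /andP[ax xb].
  rewrite (lt_le_trans _ ax) ?ltrDl// (le_lt_trans xb)//.
  by rewrite ltrBlDr ltrDl.
rewrite in_itv/= => /andP[ax xb].
have [n _ /(_ _ (leqnn n)) /= en] :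
    \forall n \near \oo, e n < Num.min (x - a) (b - x).
  by apply: (cvgr_lt _ ecvg); rewrite lt_min !subr_gt0 ax.
exists n => //=; rewrite in_itv/=.
move: en; rewrite lt_min => /andP[? ?]; apply/andP; split; lra.
Qed.

(* [f1] and [f2] are kept on separate sides because both integrals may be
   infinite. *)
Lemma ge0_integral_oo_FTC2 (f1 f2 F : R -> R) (a b la lb : R) : a < b ->
  {in `]a, b[, continuous f1} ->
  {in `]a, b[, continuous f2} ->
  {in `]a, b[, forall x, 0 <= f1 x} ->
  {in `]a, b[, forall x, 0 <= f2 x} ->
  {in `]a, b[, forall x : R, is_derive x 1 F (f1 x - f2 x)} ->
  F x @[x --> a^'+] --> la -> F x @[x --> b^'-] --> lb ->
  (\int[mu]_(x in `]a, b[) (f1 x)%:E =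
   \int[mu]_(x in `]a, b[) (f2 x)%:E + (lb - la)%:E)%E.
Proof.
move=> ab cf1 cf2 f1_ge0 f2_ge0 dF Fa Fb.
(* [harmonic n.+2] is 1/(n+3), so [e n] is at most a third of the length and no shrunken interval is
   degenerate. *)
pose e n : R := (b - a) * harmonic n.+2.
have ba0 : 0 < b - a by rewrite subr_gt0.
have e0 n : 0 < e n by rewrite /e mulr_gt0// harmonic_gt0.
have ecvg : e n @[n --> \oo] --> 0.
  rewrite -[X in _ --> X](mulr0 (b - a)); apply: cvgMr.
  have := @cvg_harmonic R; rewrite -(cvg_shiftn 2)/=.
  by under eq_fun do rewrite addn2.
have e_lt n : a + e n < b - e n.
  have : e n <= (b - a) / 3.
    by rewrite /e ler_pM2l//= lef_pV2 ?posrE// ler_nat.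
  by lra.
have e_noninc n p : (n <= p)%N -> e p <= e n.
  by move=> np; rewrite /e ler_pM2l//= lef_pV2 ?posrE// ler_nat !ltnS.
have sub n : `[a + e n, b - e n]%classic `<=` `]a, b[%classic.
  by rewrite -(bigcup_itv_shrink a b e0 ecvg) => x xn; exists n.
have within_cts (f : R -> R) n : {in `]a, b[, continuous f} ->
    {within `[a + e n, b - e n], continuous f}.
  by move=> cf; apply: continuous_in_subspaceT => x /[!inE] /sub/cf.
(* Monotone convergence along the exhaustion; the limit may be infinite. *)
have cvg_int (f : R -> R) : {in `]a, b[, continuous f} ->
    {in `]a, b[, forall x, 0 <= f x} ->
    (\int[mu]_(x in `[(a + e n)%R, (b - e n)%R]) (f x)%:E @[n --> \oo] -->
     \int[mu]_(x in `]a, b[) (f x)%:E)%E.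
  move=> cf f0; rewrite -(bigcup_itv_shrink a b e0 ecvg).
  apply: ge0_nondecreasing_set_cvg_integral => //.
  - move=> n p np; apply/subsetPset => x /=; rewrite !in_itv/= => /andP[? ?].
    by have := e_noninc _ _ np; move=> ?; apply/andP; split; lra.
  - move=> n; apply/measurable_EFinP.
    apply: subspace_continuous_measurable_fun; first exact: measurable_itv.
    exact: within_cts.
  - by move=> n x /sub/f0; rewrite lee_fin.
(* On a compact subinterval both integrals are finite, so the usual theorem for [f1 \- f2] may be
   split and rearranged. *)
have step n : (\int[mu]_(x in `[(a + e n)%R, (b - e n)%R]) (f1 x)%:E =
    \int[mu]_(x in `[(a + e n)%R, (b - e n)%R]) (f2 x)%:E
    + (F (b - e n)%R - F (a + e n)%R)%:E)%E.
  have int (f : R -> R) : {in `]a, b[, continuous f} ->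
      mu.-integrable `[a + e n, b - e n] (EFin \o f).
    move=> cf; apply: continuous_compact_integrable; first exact: segment_compact.
    exact: within_cts.
  have i2 := int _ cf2.
  rewrite EFinB -(@continuous_FTC2 _ (f1 \- f2) F)//.
  - rewrite (_ : (\int[mu]_(x in _) ((f1 \- f2) x)%:E =
      \int[mu]_(x in `[(a + e n)%R, (b - e n)%R]) (f1 x)%:E -
      \int[mu]_(x in `[(a + e n)%R, (b - e n)%R]) (f2 x)%:E)%E); last first.
      by rewrite -integralB_EFin//; exact: int.
    rewrite addeC subeK//; exact: integrable_fin_num.
  - by apply: within_cts => x xab; apply: continuousB; [exact: cf1|exact: cf2].
  - have ctsF x : x \in `[a + e n, b - e n] -> {for x, continuous F}.
      move=> /sub/dF dFx.
      exact/differentiable_continuous/derivable1_diffP/ex_derive.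
    split=> [x xab||].
    + have /dF dFx : x \in `]a, b[ by exact: sub (subset_itv_oo_cc xab).
      exact: ex_derive.
    + by apply: cvg_at_right_filter; apply: ctsF; rewrite in_itv/= lexx ltW.
    + by apply: cvg_at_left_filter; apply: ctsF; rewrite in_itv/= lexx ltW.
  - move=> x /subset_itv_oo_cc/sub/dF dFx.
    by rewrite derive1E derive_val.
apply: (cvg_unique _ (cvg_int _ cf1 f1_ge0)) => //.
rewrite /=; under eq_fun do rewrite step.
apply: cvgeD; first by rewrite fin_num_adde_defl.
  exact: cvg_int.
apply: cvg_EFin; first exact: nearW.
apply: cvgB.
  move/cvg_at_leftP : Fb; apply; split.
    by move=> n; rewrite ltrBlDr ltrDl.
  by rewrite -[X in _ --> X]subr0; apply: cvgB => //; exact: cvg_cst.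
move/cvg_at_rightP : Fa; apply; split.
  by move=> n; rewrite ltrDl.
by rewrite -[X in _ --> X]addr0; apply: cvgD => //; exact: cvg_cst.
Qed.

End improper_integral.

(** * The beta integral: recurrences, finiteness, positivity and bounds under integer shifts *)

Section beta_recurrence.
Variable R : realType.
Local Notation mu := (@lebesgue_measure R).
Implicit Types a b v : R.

Definition beta_integrand a b v : R := v `^ (a - 1) * (1 - v) `^ (b - 1).

(** Extended-real valued, so that the recurrences can be proved before finiteness is known. *)
Definition ebeta a b : \bar R :=
  (\int[mu]_(v in `]0%R, 1%R[) (beta_integrand a b v)%:E)%E.

Lemma is_derive_powR_onem (b v : R) : v < 1 ->
  is_derive v 1 (fun w => (1 - w) `^ b) (- (b * (1 - v) `^ (b - 1))).
Proof.
move=> v1.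
have dp : is_derive (1 - v) 1 (@powR R ^~ b) (b * (1 - v) `^ (b - 1)).
  by apply: is_derive1_powR; rewrite subr_gt0.
apply: (is_derive_eq
  (@is_derive1_comp R (@powR R ^~ b) (fun w : R => 1 - w) v _ _ dp _)).
by rewrite add0r mul1r mulrN1.
Qed.

Lemma continuous_powR_gt0 (a v : R) : 0 < v ->
  {for v, continuous (fun w : R => w `^ a)}.
Proof.
move=> v0; apply/differentiable_continuous/derivable1_diffP.
by have := is_derive1_powR a v0 => ?; exact: ex_derive.
Qed.

Lemma continuous_powR_onem (b v : R) : v < 1 ->
  {for v, continuous (fun w : R => (1 - w) `^ b)}.
Proof.
move=> v1; apply/differentiable_continuous/derivable1_diffP.
by have := is_derive_powR_onem b v1 => ?; exact: ex_derive.
Qed.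

Lemma continuous_beta_integrand a b :
  {in `]0, 1[, continuous (beta_integrand a b)}.
Proof.
move=> v; rewrite in_itv/= => /andP[v0 v1].
apply: (@continuousM R R (fun w : R => w `^ (a - 1))
  (fun w : R => (1 - w) `^ (b - 1))).
  exact: continuous_powR_gt0.
exact: continuous_powR_onem.
Qed.

Lemma measurable_beta_integrand a b :
  measurable_fun `](0 : R), 1[ (fun v : R => (beta_integrand a b v)%:E).
Proof.
apply/measurable_EFinP; apply: open_continuous_measurable_fun.
  exact: itv_open.
by move=> v /[!inE] v01; exact: continuous_beta_integrand.
Qed.

Lemma beta_integrand_ge0 a b v : 0 <= beta_integrand a b v.
Proof. by rewrite mulr_ge0 ?powR_ge0. Qed.

Lemma ebeta_ge0 a b : (0 <= ebeta a b)%E.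
Proof. by apply: integral_ge0 => v _; rewrite lee_fin beta_integrand_ge0. Qed.

Lemma powR_at_left1_cvg0 b : 0 < b -> (1 - v) `^ b @[v --> 1^'-] --> 0.
Proof.
move=> b0; apply/cvg_at_leftP => u [u1 ucvg].
have /cvg_at_rightP := powR_cvg0 b0; apply; split.
  by move=> n; rewrite subr_gt0.
by rewrite -[X in _ --> X](subrr (1 : R)); apply: cvgB => //; exact: cvg_cst.
Qed.

(** The two sides integrate the positive and negative parts of the derivative of v^a (1 - v)^b, a
    function that vanishes at 0 and 1. *)
Lemma ebeta_exchange a b : 0 < a -> 0 < b ->
  (a%:E * ebeta a (b + 1) = b%:E * ebeta (a + 1) b)%E.
Proof.
move=> a0 b0; rewrite /ebeta.
have intZ k c d : 0 < k ->
    (k%:E * \int[mu]_(v in `]0%R, 1%R[) (beta_integrand c d v)%:E =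
    \int[mu]_(v in `]0%R, 1%R[) (k * beta_integrand c d v)%:E)%E.
  move=> k0; rewrite -ge0_integralZl_EFin ?ltW//.
    by move=> v _; rewrite lee_fin beta_integrand_ge0.
  exact: measurable_beta_integrand.
rewrite (intZ _ _ _ a0) (intZ _ _ _ b0).
have cts c d e : {in `]0, 1[, continuous (fun v => c * beta_integrand d e v)}.
  move=> v /(@continuous_beta_integrand d e) ?.
  by apply: continuousM => //; exact: cst_continuous.
have ge0r c d e : 0 < c -> {in `]0, 1[, forall v : R, 0 <= c * beta_integrand d e v}.
  by move=> c0 v _; rewrite mulr_ge0 ?beta_integrand_ge0 ?ltW.
have -> := @ge0_integral_oo_FTC2 R (fun v => a * beta_integrand a (b + 1) v)
   (fun v => b * beta_integrand (a + 1) b v) (fun v => v `^ a * (1 - v) `^ b)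
   0 1 0 0 ltr01 (cts _ _ _) (cts _ _ _) (ge0r _ _ _ a0) (ge0r _ _ _ b0).
- by rewrite subr0 adde0.
- move=> v; rewrite in_itv/= => /andP[v0 v1].
  have da := is_derive1_powR a v0.
  have db := is_derive_powR_onem b v1.
  apply: (is_derive_eq (is_deriveM da db)).
  rewrite /beta_integrand !addrK /GRing.scale/=; ring.
(* At each endpoint one factor tends to 0, its exponent being positive, and the other is
   continuous. *)
- rewrite -[X in _ --> X](mul0r ((1 - 0) `^ b : R)).
  apply: cvgM; first exact: powR_cvg0.
  apply: cvg_at_right_filter. exact: continuous_powR_onem (@ltr01 R).
- rewrite -[X in _ --> X](mulr0 (1 `^ a : R)).
  apply: cvgM; last exact: powR_at_left1_cvg0.
  apply: cvg_at_left_filter. exact: continuous_powR_gt0 (@ltr01 R).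
Qed.

(** Multiply the integrand by v + (1 - v) = 1. *)
Lemma ebetaD a b : 0 < a -> 0 < b ->
  (ebeta a b = ebeta (a + 1) b + ebeta a (b + 1))%E.
Proof.
move=> a0 b0; rewrite /ebeta -ge0_integralD//; first last.
- exact: measurable_beta_integrand.
- by move=> v _; rewrite lee_fin beta_integrand_ge0.
- exact: measurable_beta_integrand.
- by move=> v _; rewrite lee_fin beta_integrand_ge0.
apply: eq_integral => v; rewrite inE/= in_itv/= => /andP[v0 v1].
rewrite -EFinD /beta_integrand !addrK; congr EFin.
rewrite -(mulr_powRB1 (ltW v0) a0) -(@mulr_powRB1 _ (1 - v) b)//; last first.
  by rewrite subr_ge0 ltW.
by ring.
Qed.

(* [ebeta_exchange] and [ebetaD] hold in the extended reals, so finiteness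
   descends from [ebeta (a + 1) (b + 1)], whose integrand is at most 1. *)
Lemma ebeta_lty a b : 0 < a -> 0 < b -> (ebeta a b < +oo)%E.
Proof.
have lty1 c d : 0 < c -> 0 < d -> (ebeta (c + 1) (d + 1) < +oo)%E.
  move=> c0 d0; apply: (@le_lt_trans _ _ (\int[mu]_(v in `]0%R, 1%R[) cst 1 v)%E).
    apply: ge0_le_integral => //.
    - by move=> v _; rewrite lee_fin beta_integrand_ge0.
    - exact: measurable_beta_integrand.
    - move=> v /=; rewrite in_itv/= => /andP[v0 v1].
      rewrite lee_fin /beta_integrand !addrK.
      have le1 w p : 0 < w <= 1 -> 0 < p -> w `^ p <= 1.
        by move=> w01 p0; rewrite -(powRr0 w); apply: ger_powR => //; exact: ltW.
      rewrite mulr_ile1 ?powR_ge0//; apply: le1 => //; apply/andP; split; lra.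
  rewrite integral_cst//= lebesgue_measure_itv/= lte_fin ltr01.
  by rewrite mul1e oppr0 adde0 ltry.
have cancel_lty (c : R) (x : \bar R) : 0 < c -> (c%:E * x < +oo -> x < +oo)%E.
  move=> c0; rewrite !ltey; apply: contra => /eqP ->.
  by rewrite gt0_muley ?lte_fin.
(* [ebetaD] splits off a term with both parameters above 1; [ebeta_exchange] turns the remaining one
   into a multiple of such a term. *)
have ltyl c d : 0 < c -> 0 < d -> (ebeta (c + 1) d < +oo)%E.
  move=> c0 d0; have c1 : 0 < c + 1 by exact: addr_gt0.
  rewrite (ebetaD c1 d0); apply: lte_add_pinfty; last exact: lty1.
  apply: (cancel_lty d) => //; rewrite -(ebeta_exchange c1 d0).
  by apply: lte_mul_pinfty => //; [rewrite lee_fin ltW|exact: lty1].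
move=> a0 b0; rewrite (ebetaD a0 b0).
apply: lte_add_pinfty; first exact: ltyl.
apply: (cancel_lty a) => //; rewrite (ebeta_exchange a0 b0).
by apply: lte_mul_pinfty => //; [rewrite lee_fin ltW|exact: ltyl].
Qed.

Lemma beta_realE a b : 0 < a -> 0 < b -> (beta_real a b)%:E = ebeta a b.
Proof.
by move=> a0 b0; rewrite fineK// ge0_fin_numE ?ebeta_ge0 ?ebeta_lty.
Qed.

(** A zero integral would force the integrand to vanish almost everywhere, yet it is positive on an
    interval of measure 1. *)
Lemma beta_real_gt0 a b : 0 < a -> 0 < b -> 0 < beta_real a b.
Proof.
move=> a0 b0; rewrite -lte_fin beta_realE// lt_neqAle ebeta_ge0 andbT eq_sym.
apply/eqP => eb0.
have ae0 : ae_eq mu `]0, 1[%classic (fun v => (beta_integrand a b v)%:E) (cst 0%E).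
  apply/ae_eq_integral_abs => //; first exact: measurable_beta_integrand.
  rewrite -[RHS]eb0; apply: eq_integral => v _.
  by rewrite gee0_abs// lee_fin beta_integrand_ge0.
have : mu.-negligible `]0, 1[%classic.
  apply: negligibleS ae0 => v v01 /(_ v01)/=.
  move: v01; rewrite /= in_itv/= => /andP[v0 v1] [].
  by apply/eqP; rewrite gt_eqF// mulr_gt0 ?powR_gt0 ?subr_gt0.
move/negligibleP => /(_ (measurable_itv _)).
have mu1 : mu `]0, 1[%classic = 1%E.
  by rewrite lebesgue_measure_itv/= lte_fin ltr01 oppr0 adde0.
by move/(eq_trans (esym mu1))/eqP; rewrite onee_eq0.
Qed.

(** With X = B(a+1, b) and Y = B(a, b+1), solve the linear system a Y = b X, X + Y = B(a, b) for
    X. *)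
Lemma beta_realSl a b : 0 < a -> 0 < b ->
  beta_real (a + 1) b = a / (a + b) * beta_real a b.
Proof.
move=> a0 b0; have a1 : 0 < a + 1 by rewrite addr_gt0.
have b1 : 0 < b + 1 by rewrite addr_gt0.
have := ebetaD a0 b0; have := ebeta_exchange a0 b0.
rewrite -(beta_realE a0 b0) -(beta_realE a1 b0) -(beta_realE a0 b1).
move: (beta_real a b) (beta_real (a + 1) b) (beta_real a (b + 1)) => B X Y.
rewrite -!EFinM -EFinD => -[ex] [->].
have ab : a + b != 0 by rewrite gt_eqF ?addr_gt0.
by rewrite -mulrA mulrCA mulrDr ex -mulrDl mulrA mulVf// mul1r.
Qed.

Lemma beta_realSr a b : 0 < a -> 0 < b ->
  beta_real a (b + 1) = b / (a + b) * beta_real a b.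
Proof.
move=> a0 b0; have := ebetaD a0 b0.
rewrite -!beta_realE ?addr_gt0// -EFinD => -[].
rewrite (beta_realSl a0 b0) => /esym/(canRL (addKr _)) ->.
have ab : a + b != 0 by rewrite gt_eqF ?addr_gt0.
by field.
Qed.

(** Each unit shift multiplies B by (a + i) / (a + b + i), which is smallest at i = 0. *)
Lemma beta_real_addnl_ge a b n : 0 < a -> 0 < b ->
  (a / (a + b)) ^+ n * beta_real a b <= beta_real (n%:R + a) b.
Proof.
move=> a0 b0; elim: n => [|n IH]; first by rewrite mul1r add0r.
have na : 0 < n%:R + a by rewrite ltr_wpDl.
rewrite -natr1 addrAC (beta_realSl na b0) exprS -mulrA ler_pM//.
- by rewrite divr_ge0 ?addr_ge0 ?ltW.
- by rewrite mulr_ge0 ?exprn_ge0 ?divr_ge0 ?addr_ge0 ?ltW ?beta_real_gt0.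
have ab0 : 0 < a + b by exact: addr_gt0.
rewrite ler_pdivlMr; last by rewrite addr_gt0.
rewrite mulrAC ler_pdivrMr//.
(* After cross-multiplication the two sides differ by exactly n b. *)
have : 0 <= n%:R * b by rewrite mulr_ge0 // ltW.
by nra.
Qed.

Lemma beta_real_addnr_ge a b n : 0 < a -> 0 < b ->
  (b / (a + b)) ^+ n * beta_real a b <= beta_real a (n%:R + b).
Proof.
move=> a0 b0; elim: n => [|n IH]; first by rewrite mul1r add0r.
have nb : 0 < n%:R + b by rewrite ltr_wpDl.
rewrite -natr1 addrAC (beta_realSr a0 nb) exprS -mulrA ler_pM//.
- by rewrite divr_ge0 ?addr_ge0 ?ltW.
- by rewrite mulr_ge0 ?exprn_ge0 ?divr_ge0 ?addr_ge0 ?ltW ?beta_real_gt0.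
have ab0 : 0 < a + b by exact: addr_gt0.
rewrite ler_pdivlMr; last by rewrite addr_gt0.
rewrite mulrAC ler_pdivrMr//.
have : 0 <= n%:R * a by rewrite mulr_ge0 // ltW.
by nra.
Qed.

End beta_recurrence.

(* [ge0_le_integral] would require [likelihood] to be measurable in [r]. *)
Lemma ge0_integral_mono d (T : measurableType d) (R : realType)
    (mu : {measure set T -> \bar R}) (D : set T) (f1 f2 : T -> \bar R) :
  (forall t, D t -> 0 <= f1 t)%E -> (forall t, D t -> f1 t <= f2 t)%E ->
  (\int[mu]_(t in D) f1 t <= \int[mu]_(t in D) f2 t)%E.
Proof.
move=> f1_ge0 f12.
have f2_ge0 t : D t -> (0 <= f2 t)%E.
  by move=> Dt; exact: le_trans (f1_ge0 _ Dt) (f12 _ Dt).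
(* The integral is a supremum over simple functions below the integrand; a larger integrand admits
   more of them. *)
rewrite !ge0_integralE//; apply: le_ereal_sup => _ [h /= hf1 <-]; exists h => //= t.
apply: le_trans (hf1 t) _; rewrite !patchE; case: ifPn => // /[!inE]; exact: f12.
Qed.

(** * A positive lower bound on the likelihood, uniform in r *)

Section likelihood_bound.
Variables (R : realType) (k m : nat) (n y : 'I_k -> nat) (x : 'I_k -> m.-tuple R).
Hypothesis extreme : forall j, y j = 0%N \/ y j = n j.
Implicit Types (r : R) (b : m.-tuple R).

Lemma pE_gt0 b j : 0 < pE x b j.
Proof. by rewrite divr_gt0 ?addr_gt0 ?expR_gt0. Qed.

Lemma qE_gt0 b j : 0 < qE x b j.
Proof.
by rewrite subr_gt0 ltr_pdivrMr ?addr_gt0 ?expR_gt0// mul1r ltrDr.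
Qed.

(** The binomial likelihood with success probabilities [pE]; its binomial coefficients are 1 in
    extreme groups. *)
Definition likelihood_inf b : R :=
  \prod_(j < k) (pE x b j ^+ y j * qE x b j ^+ (n j - y j)).

Lemma likelihood_inf_gt0 b : 0 < likelihood_inf b.
Proof.
by apply: prodr_gt0 => j _; rewrite mulr_gt0 ?exprn_gt0 ?pE_gt0 ?qE_gt0.
Qed.

Lemma likelihood_ge_inf r b : 0 < r -> likelihood_inf b <= likelihood n y x r b.
Proof.
move=> r0; apply: ler_prod => j _.
have p0 := pE_gt0 b j; have q0 := qE_gt0 b j.
apply/andP; split; first by rewrite mulr_ge0 ?exprn_ge0 ?ltW.
have rp0 := mulr_gt0 r0 p0; have rq0 := mulr_gt0 r0 q0.
(* Since p + q = 1, the ratios a / (a + b) and b / (a + b) reduce to p and q, and r cancels. *)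
have rpq : r * pE x b j + r * qE x b j = r by rewrite /qE; ring.
have rn0 : r != 0 by rewrite gt_eqF.
have rpK : r * pE x b j / r = pE x b j by rewrite mulrAC mulfV// mul1r.
have rqK : r * qE x b j / r = qE x b j by rewrite mulrAC mulfV// mul1r.
case: (extreme j) => ->.
  rewrite expr0 mul1r subn0 subr0 add0r bin0 mul1r.
  rewrite (ler_pdivlMr _ _ (beta_real_gt0 rp0 rq0)).
  by have := beta_real_addnr_ge (n j) rp0 rq0; rewrite rpq rqK.
rewrite subnn expr0 mulr1 subrr add0r binn mul1r.
rewrite (ler_pdivlMr _ _ (beta_real_gt0 rp0 rq0)).
by have := beta_real_addnl_ge (n j) rp0 rq0; rewrite rpq rpK.
Qed.

End likelihood_bound.

(** * Divergence of the posterior integral *)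

Theorem theorem3p5 (R : realType) (k m : nat) (m_gt0 : (1 <= m)%N)
  (m_le_k : (m <= k)%N) (n y : 'I_k -> nat) (x : 'I_k -> m.-tuple R)
  (n_gt0 : forall j, (1 <= n j)%N) (y_le_n : forall j, (y j <= n j)%N)
  (extreme : forall j, y j = 0%N \/ y j = n j)
  (f : R -> R) (g : m.-tuple R -> R)
  (f_prior : hyperprior_density lebesgue_measure `]0, +oo[ f)
  (f_improper : improper_density lebesgue_measure `]0, +oo[ f)
  (g_prior : hyperprior_density (lebesgue_tuple m) setT g) :
  posterior_improper n y x f g.
Proof.
case: f_prior => mf f_ge0 _; case: g_prior => mg g_ge0 g_nae0.
pose D := [set b | g b != 0].
have mD : measurable D.
  rewrite (_ : D = g @^-1` ~` [set 0]); last by apply/seteqP; split=> b /= /eqP.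
  rewrite -[X in measurable X]setTI; apply: mg => //.
  by apply: measurableC; exact: measurable_set1.
(* If [D] were null, [g] would vanish almost everywhere. *)
have muD0 : lebesgue_tuple m D != 0%E.
  apply: contra_notN g_nae0 => /eqP muD0.
  apply: (@negligibleS _ _ _ _ D); last exact/negligibleP.
  by move=> b /= gb0; apply/eqP => gb; apply: gb0.
have inner b : (\int[lebesgue_measure]_(r in `]0%R, +oo[)
    (f r * g b * likelihood n y x r b)%:E = ((cst +oo) \_ D) b)%E.
  rewrite patchE; case: ifPn => [|/negP]; rewrite inE /D/= => gb0; last first.
    apply: integral0_eq => r _.
    by move/negP/negPn/eqP : gb0 => ->; rewrite mulr0 mul0r.
  have gb_gt0 : 0 < g b by rewrite lt_neqAle eq_sym gb0 g_ge0.
  have c_gt0 := mulr_gt0 gb_gt0 (likelihood_inf_gt0 n y x b).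
  have fE_ge0 r : `]0%R, +oo[%classic r -> (0 <= (f r)%:E)%E.
    by move=> /f_ge0; rewrite lee_fin.
  (* Compare with a positive constant times the integral of [f], which is infinite. *)
  apply/eqP; rewrite -leye_eq; apply: (@le_trans _ _
    (\int[lebesgue_measure]_(r in `]0%R, +oo[)
       ((g b * likelihood_inf n y x b)%:E * (f r)%:E))%E).
    rewrite ge0_integralZl_EFin//; [|exact/measurable_EFinP|exact: ltW].
    by rewrite f_improper gt0_muley ?lte_fin.
  apply: ge0_integral_mono => r r0; first by rewrite mule_ge0 ?fE_ge0// lee_fin ltW.
  rewrite -EFinM lee_fin mulrC mulrA ler_wpM2l//.
    by rewrite mulr_ge0 ?f_ge0 ?g_ge0.
  by apply: likelihood_ge_inf => //; move: r0; rewrite /= in_itv/= andbT.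
rewrite /posterior_improper /posterior_integral.
(* What remains is +oo times the measure of [D]. *)
under eq_integral do rewrite inner.
rewrite -integral_mkcond integral_cst// gt0_mulye//.
by rewrite lt_neqAle eq_sym muD0 measure_ge0.
Qed.
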